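(* Let $m,n\in\mathbb{N}$, let $\mathbf{A}\in\mathbb{IR}^{m\times n}$ be an interval matrix, $\mathbf{b}\in\mathbb{IR}^m$ an interval vector, $\mathcal{A}\in\{\forall,\exists\}^{m\times n}$ a quantifier matrix, $\beta\in\{\forall,\exists\}^m$ a quantifier vector, and $\sigma\in\{=,\ge,\le\}^m$ a vector of relations. Let $Q(\mathbf{A},\mathbf{b},\mathcal{A},\beta)$ be a quantifier prefix with an arbitrary order of its elementary prefixes; let $Q^{\forall\exists}(\mathbf{A},\mathbf{b},\mathcal{A},\beta)$ be any quantifier prefix such that for each $i\in\{1,\dots,m\}$, among the elementary prefixes related to the $i$-th row, the universal quantifiers (if any) precede the existential ones (if any); and let $Q^{\sigma}(\mathbf{A},\mathbf{b},\mathcal{A},\beta)$ be any quantifier prefix such that this condition holds for each $i$ for which $\sigma_i$ is ``$=$''. Then for every $x\in\mathbb{R}^n$, $$Q^{\forall\exists}(\mathbf{A},\mathbf{b},\mathcal{A},\beta)\ (Ax=b)\ \Longleftrightarrow\ |\check{\mathbf{A}}x-\check{\mathbf{b}}|\le(\mathcal{A}^s\circ\hat{\mathbf{A}})|x|+\beta^s\circ\hat{\mathbf{b}},$$ $$Q(\mathbf{A},\mathbf{b},\mathcal{A},\beta)\ (Ax\ge b)\ \Longleftrightarrow\ \check{\mathbf{b}}-\check{\mathbf{A}}x\le(\mathcal{A}^s\circ\hat{\mathbf{A}})|x|+\beta^s\circ\hat{\mathbf{b}},$$ $$Q(\mathbf{A},\mathbf{b},\mathcal{A},\beta)\ (Ax\le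 b)\ \Longleftrightarrow\ \check{\mathbf{A}}x-\check{\mathbf{b}}\le(\mathcal{A}^s\circ\hat{\mathbf{A}})|x|+\beta^s\circ\hat{\mathbf{b}},$$ $$Q^{\sigma}(\mathbf{A},\mathbf{b},\mathcal{A},\beta)\ (Ax\,\sigma\,b)\ \Longleftrightarrow\ \operatorname{abs}^{\sigma}(\check{\mathbf{A}}x-\check{\mathbf{b}})\le(\mathcal{A}^s\circ\hat{\mathbf{A}})|x|+\beta^s\circ\hat{\mathbf{b}},$$ where $\mathcal{A}^s_{ij}=1$ if $\mathcal{A}_{ij}=\exists$ and $\mathcal{A}^s_{ij}=-1$ if $\mathcal{A}_{ij}=\forall$; $\beta^s_i=1$ if $\beta_i=\exists$ and $\beta^s_i=-1$ if $\beta_i=\forall$; and for $y\in\mathbb{R}^m$ the $i$-th component of $\operatorname{abs}^{\sigma}(y)$ is $|y_i|$ if $\sigma_i$ is ``$=$'', $-y_i$ if $\sigma_i$ is ``$\ge$'', and $y_i$ if $\sigma_i$ is ``$\le$''.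
   Context: Intervals. $\mathbb{IR}$ is the set of intervals $\mathbf{u}=[\underline{\mathbf{u}},\overline{\mathbf{u}}]=\{u\in\mathbb{R}:\underline{\mathbf{u}}\le u\le\overline{\mathbf{u}}\}$ with real $\underline{\mathbf{u}}\le\overline{\mathbf{u}}$. Midpoint: $\check{\mathbf{u}}=(\underline{\mathbf{u}}+\overline{\mathbf{u}})/2$; radius: $\hat{\mathbf{u}}=(\overline{\mathbf{u}}-\underline{\mathbf{u}})/2$. For interval matrices and vectors, midpoint and radius are taken componentwise. $\circ$ is the Hadamard (entrywise) product, $(A\circ B)_{ij}=A_{ij}B_{ij}$, also used for vectors. The modulus $|x|$ of a vector and inequalities between vectors are componentwise. Quantifier prefixes. With each parameter $A_{ij}$ associate the elementary prefix $(\mathcal{A}_{ij}\,A_{ij}\in\mathbf{A}_{ij})$, and with each parameter $b_i$ the elementary prefix $(\beta_i\,b_i\in\mathbf{b}_i)$. $Q(\mathbf{A},\mathbf{b},\mathcal{A},\beta)$ denotes a prefix of length $m(n+1)$ containing each of these elementary prefixes exactly once, in an arbitrary order; superscripts on $Q$ indicate additional conditions on this order. The elementary prefixes related to the $i$-th row are those of $A_{i1},\dots,A_{in},b_i$. The predicate $Q(\mathbf{A},\mathbf{b},\mathcal{A},\beta)\,(Ax\,\sigma\,b)$ has free variable $x\in\mathbb{R}^n$, and $Ax\,\sigma\,b$ is the conjunction over $i$ of $\bigl(\sum_j A_{ij}x_j\bigr)\,\sigma_i\,b_i$; $Ax=b$, $Ax\ge b$, $Ax\le b$ are the cases where all components of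 $\sigma$ are ``$=$'', ``$\ge$'', ``$\le$'' respectively. *)

(* Defs.v *)
From mathcomp Require Import all_boot all_order all_algebra.
From mathcomp Require Import reals.

Set Implicit Arguments.
Unset Strict Implicit.
Unset Printing Implicit Defensive.

Import Order.TTheory GRing.Theory Num.Theory.
Local Open Scope ring_scope.

Record IR (R : realType) := MkIR {
  lower : R;
  upper : R;
  lower_le_upper : lower <= upper
}.

Definition in_IR (R : realType) (u : IR R) (t : R) : Prop :=
  lower u <= t <= upper u.

Definition midpoint (R : realType) (u : IR R) : R := (lower u + upper u) / 2.

Definition radius (R : realType) (u : IR R) : R := (upper u - lower u) / 2.

Definition hadamard (R : realType) (m n : nat) (A B : 'M[R]_(m, n)) :
  'M[R]_(m, n) := map2_mx (fun a b => a * b) A B.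

Definition modulus (R : realType) (n : nat) (x : 'cV[R]_n) : 'cV[R]_n :=
  map_mx (fun t => `|t|) x.

Definition le_cV (R : realType) (m : nat) (u v : 'cV[R]_m) : Prop :=
  forall i : 'I_m, u i ord0 <= v i ord0.

Inductive quantifier := QForall | QExists.

Definition qsign (R : realType) (q : quantifier) : R :=
  match q with QForall => -1 | QExists => 1 end.

Inductive relsym := RelEq | RelGe | RelLe.

Definition rel_holds (R : realType) (s : relsym) (y z : R) : Prop :=
  match s with
  | RelEq => y = z
  | RelGe => y >= z
  | RelLe => y <= z
  end.

Definition abs_sigma (R : realType) (m : nat) (sigma : 'cV[relsym]_m)
    (y : 'cV[R]_m) : 'cV[R]_m :=
  \col_i match sigma i ord0 with
         | RelEq => `|y i ord0|
         | RelGe => - y i ord0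
         | RelLe => y i ord0
         end.

Definition rel_system (R : realType) (m n : nat) (sigma : 'cV[relsym]_m)
    (x : 'cV[R]_n) (A : 'M[R]_(m, n)) (b : 'cV[R]_m) : Prop :=
  forall i : 'I_m, rel_holds (sigma i ord0) ((A *m x) i ord0) (b i ord0).

(* [inl (i, j)] stands for the parameter A_ij and [inr i] for b_i. *)
Definition param (m n : nat) := ('I_m * 'I_n + 'I_m)%type.

Definition param_row (m n : nat) (p : param m n) : 'I_m :=
  match p with inl ij => ij.1 | inr i => i end.

Definition param_entry (T : Type) (m n : nat) (A : 'M[T]_(m, n)) (b : 'cV[T]_m)
    (p : param m n) : T :=
  match p with inl ij => A ij.1 ij.2 | inr i => b i ord0 end.

(* An elementary prefix is determined by its parameter once the interval and
   quantifier data are fixed, so a prefix is represented by the sequence of its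
   parameters, outermost quantifier first. *)
Definition quant_prefix (m n : nat) (Q : seq (param m n)) : Prop :=
  forall p : param m n, count_mem p Q = 1%N.

Definition row_forall_exists (m n : nat) (cA : 'M[quantifier]_(m, n))
    (beta : 'cV[quantifier]_m) (Q : seq (param m n)) (i : 'I_m) : Prop :=
  forall p q : param m n,
    param_row p = i -> param_row q = i ->
    param_entry cA beta p = QForall -> param_entry cA beta q = QExists ->
    (index p Q < index q Q)%N.

Definition bounded_quant (R : realType) (q : quantifier) (u : IR R)
    (P : R -> Prop) : Prop :=
  match q with
  | QForall => forall t : R, in_IR u t -> P t
  | QExists => exists t : R, in_IR u t /\ P t
  end.

Fixpoint quantify (R : realType) (m n : nat) (A : 'M[IR R]_(m, n))
    (b : 'cV[IR R]_m) (cA : 'M[quantifier]_(m, n)) (beta : 'cV[quantifier]_m)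
    (Q : seq (param m n)) (P : (param m n -> R) -> Prop)
    (v : param m n -> R) : Prop :=
  match Q with
  | [::] => P v
  | p :: Q' =>
      bounded_quant (param_entry cA beta p) (param_entry A b p)
        (fun t => quantify A b cA beta Q' P [eta v with p |-> t])
  end.

(* The initial valuation [fun=> 0] is a dummy: a prefix satisfying
   [quant_prefix] binds every parameter. *)
Definition quantified (R : realType) (m n : nat) (A : 'M[IR R]_(m, n))
    (b : 'cV[IR R]_m) (cA : 'M[quantifier]_(m, n)) (beta : 'cV[quantifier]_m)
    (Q : seq (param m n)) (P : 'M[R]_(m, n) -> 'cV[R]_m -> Prop) : Prop :=
  quantify A b cA beta Q
    (fun v => P (\matrix_(i, j) v (inl (i, j))) (\col_i v (inr i)))
    (fun=> 0).

(* Main.v *)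
Require Import Defs.
From mathcomp Require Import all_boot all_order all_algebra.
From mathcomp Require Import reals.
From mathcomp Require Import ring lra.

(** The quantifiers are eliminated one at a time, from the innermost outwards.
    For a row with relation [s], write the constraint as [s] between the linear
    form [L v = \sum_p c p * v p] (with [c] the entries of [x] on the matrix
    parameters and [-1] on the right-hand side) and [0].  With all parameters
    fixed this says that [residual s (L v) <= 0], where [residual] is the
    absolute value, the opposite or the identity.

    Replacing a parameter fixed at the midpoint of its interval by a value
    ranging over that interval moves [L v] by an arbitrary amount [d] with
    [`|d| <= D], where [D] is the radius times [`|c p|].  If the current
    condition is [residual s y <= r], then quantifying universally over [d]
    turns it into [residual s y <= r - D], and existentially into
    [residual s y <= r + D] ([residual_le_forall], [residual_le_exists]).  So
    each elimination puts the parameter at its midpoint and adds one signed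
    radius to the right-hand side.

    The only obstruction is the existential step for an equation, which fails
    when [r < 0]: the condition [`|y + d| <= r] is then unsatisfiable although
    [`|y| <= r + D] may hold.  When the universal quantifiers of the row
    precede its existential ones, every parameter of that row already
    eliminated at such a step was existential, so [r] is a sum of nonnegative terms.  Inequalities do
    not constrain the order, since their residual is linear.  A step acts on a
    single row and the other rows do not depend on the quantified value, which
    is why orderings across rows are irrelevant ([quantify_le_budget]). *)

Set Implicit Arguments.
Unset Strict Implicit.
Unset Printing Implicit Defensive.

Import Order.TTheory GRing.Theory Num.Theory.
Local Open Scope ring_scope.

(** * Intervals in midpoint-radius form *)

Lemma radius_ge0 (R : realType) (u : IR R) : 0 <= radius u.
Proof.
have := lower_le_upper u; rewrite /radius => ?; lra.
Qed.

Lemma in_IR_dist (R : realType) (u : IR R) (t : R) :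
  in_IR u t <-> `|t - midpoint u| <= radius u.
Proof.
rewrite /in_IR /midpoint /radius ler_norml.
by split=> /andP[? ?]; apply/andP; split; lra.
Qed.

Lemma in_IR_midpoint (R : realType) (u : IR R) : in_IR u (midpoint u).
Proof. by apply/in_IR_dist; rewrite subrr normr0 radius_ge0. Qed.

Lemma in_IR_scaled_dist (R : realType) (u : IR R) (c t : R) :
  in_IR u t -> `|c * (t - midpoint u)| <= radius u * `|c|.
Proof. by move=> /in_IR_dist ut; rewrite normrM mulrC ler_wpM2r. Qed.

Lemma in_IR_scaled_surj (R : realType) (u : IR R) (c d : R) :
  `|d| <= radius u * `|c| ->
  exists2 t, in_IR u t & c * (t - midpoint u) = d.
Proof.
have [-> | c0] := eqVneq c 0.
  rewrite normr0 mulr0 normr_le0 => /eqP ->.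
  by exists (midpoint u); [exact: in_IR_midpoint | rewrite mul0r].
move=> dle; exists (midpoint u + d / c); last by field.
apply/in_IR_dist; rewrite addrAC subrr add0r normrM normfV.
by rewrite ler_pdivrMr // normr_gt0.
Qed.

(** * Eliminating one quantifier from one row *)

Definition residual (R : realType) (s : relsym) (y : R) : R :=
  match s with
  | RelEq => `|y|
  | RelGe => - y
  | RelLe => y
  end.

Lemma rel_holds_residual (R : realType) (s : relsym) (y : R) :
  rel_holds s y 0 <-> residual s y <= 0.
Proof.
case: s => /=; last by [].
- by rewrite normr_le0; split=> [->|/eqP].
- by rewrite oppr_le0.
Qed.

Lemma residual_le_forall (R : realType) (s : relsym) (y D r : R) :
  0 <= D ->
  (forall d, `|d| <= D -> residual s (y + d) <= r) <->
  residual s y <= r - D.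
Proof.
move=> D0; split=> [H | H d].
  have [HD HN] : residual s (y + D) <= r /\ residual s (y - D) <= r.
    by split; apply: H; rewrite ?normrN ger0_norm.
  case: s {H} HD HN => /=; [|by move=> *; lra..].
  rewrite !ler_norml => /andP[? ?] /andP[? ?].
  by apply/andP; split; lra.
rewrite ler_norml => /andP[? ?].
case: s H => /=; [|by move=> *; lra..].
by rewrite !ler_norml => /andP[? ?]; apply/andP; split; lra.
Qed.

Lemma residual_le_exists (R : realType) (s : relsym) (y D r : R) :
  0 <= D -> (s = RelEq -> 0 <= r) ->
  (exists d, `|d| <= D /\ residual s (y + d) <= r) <->
  residual s y <= r + D.
Proof.
move=> D0 r0; split=> [[d []] | ].
  rewrite ler_norml => /andP[? ?].
  case: s {r0} => /=; [|by move=> *; lra..].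
  by rewrite !ler_norml => /andP[? ?]; apply/andP; split; lra.
case: s r0 => /= r0 H.
- move/(_ erefl): r0 => r0; move: H; rewrite ler_norml => /andP[? ?].
  (* The shift bringing y as close to 0 as the radius D allows. *)
  have [yD | Dy] := lerP y D; last first.
    exists (- D); rewrite normrN ger0_norm //; split=> //.
    by rewrite ler_norml; apply/andP; split; lra.
  have [Ny | yN] := lerP (- D) y.
    exists (- y); rewrite normrN subrr normr0; split=> //.
    by rewrite ler_norml; apply/andP; split.
  exists D; rewrite ger0_norm //; split=> //.
  by rewrite ler_norml; apply/andP; split; lra.
- by exists D; rewrite ger0_norm //; split=> //; lra.
- by exists (- D); rewrite normrN ger0_norm //; split=> //; lra.
Qed.

Lemma bounded_quant_residual (R : realType) (q : quantifier) (u : IR R)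
    (s : relsym) (y c r : R) :
  (q = QExists -> s = RelEq -> 0 <= r) ->
  bounded_quant q u (fun t => residual s (y + c * (t - midpoint u)) <= r) <->
  residual s y <= r + qsign R q * radius u * `|c|.
Proof.
have D0 : 0 <= radius u * `|c| by rewrite mulr_ge0 ?radius_ge0.
case: q => /= r0.
- rewrite -mulrA mulN1r; split=> [H | /residual_le_forall H t ut].
    apply/residual_le_forall => // d /in_IR_scaled_surj[t ut <-].
    exact: H.
  by apply: H => //; exact: in_IR_scaled_dist.
- rewrite mul1r; split=> [[t [ut H]] | /residual_le_exists H].
    apply/residual_le_exists; [by []|exact: r0|].
    by exists (c * (t - midpoint u)); split=> //; exact: in_IR_scaled_dist.
  have [||d [/in_IR_scaled_surj[t ut <-] Hd]] := H; [by []|exact: r0|].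
  by exists t.
Qed.

Lemma bounded_quant_iff (R : realType) (q : quantifier) (u : IR R)
    (P P' : R -> Prop) :
  (forall t, P t <-> P' t) -> bounded_quant q u P <-> bounded_quant q u P'.
Proof.
move=> PP'; case: q => /=; first by split=> H t ut; apply/PP'; exact: H.
by split=> -[t [ut /PP' Pt]]; exists t.
Qed.

(** Intervals are nonempty, so a universal quantifier does not make a
    conjunct independent of the quantified value vacuous. *)
Lemma bounded_quant_andl (R : realType) (q : quantifier) (u : IR R)
    (P : R -> Prop) (C : Prop) :
  bounded_quant q u (fun t => P t /\ C) <-> bounded_quant q u P /\ C.
Proof.
case: q => /=; split.
- move=> H; split=> [t /H[]//|].
  by have [] := H _ (in_IR_midpoint u).
- by move=> [H HC] t /H.
- by move=> [t [ut [Pt HC]]]; split=> //; exists t.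
- by move=> [[t [ut Pt]] HC]; exists t.
Qed.

(** * Eliminating the whole prefix *)

Lemma quantify_iff (R : realType) (m n : nat) (A : 'M[IR R]_(m, n))
    (b : 'cV[IR R]_m) (cA : 'M[quantifier]_(m, n)) (beta : 'cV[quantifier]_m)
    (Q : seq (param m n)) (P P' : (param m n -> R) -> Prop) :
  (forall v, P v <-> P' v) ->
  forall v, quantify A b cA beta Q P v <-> quantify A b cA beta Q P' v.
Proof.
move=> PP'; elim: Q => [|p Q IH] v //=.
by apply: bounded_quant_iff => t; exact: IH.
Qed.

Definition row_form (R : realType) (m n : nat) (c v : param m n -> R)
    (i : 'I_m) : R :=
  \sum_(p : param m n | param_row p == i) c p * v p.

Lemma row_form_update (R : realType) (m n : nat) (c v v' : param m n -> R)
    (p : param m n) (i : 'I_m) :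
  (forall q, q != p -> v' q = v q) ->
  row_form c v' i =
  row_form c v i + (if param_row p == i then c p * (v' p - v p) else 0).
Proof.
move=> vv'; rewrite /row_form; case: ifPn => pi.
  rewrite (bigD1 p) //= [in RHS](bigD1 p) //=.
  rewrite (eq_bigr (fun q => c q * v q)) => [|q /andP[_ /vv' ->] //].
  by rewrite addrAC; congr (_ + _); ring.
rewrite addr0; apply: eq_bigr => q /eqP qi.
by rewrite vv' //; apply: contraNneq pi => <-; apply/eqP.
Qed.

(** The valuation at which the innermost quantifiers [s] have been replaced by
    the midpoints of their intervals, the outer parameters keeping their
    current values. *)
Definition at_midpoints (R : realType) (m n : nat) (A : 'M[IR R]_(m, n))
    (b : 'cV[IR R]_m) (s : seq (param m n)) (v : param m n -> R) :
    param m n -> R :=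
  fun p => if p \in s then midpoint (param_entry A b p) else v p.

(** The right-hand side accumulated by eliminating the quantifiers [s]; for a
    full prefix it is the bound of the row. *)
Definition budget (R : realType) (m n : nat) (A : 'M[IR R]_(m, n))
    (b : 'cV[IR R]_m) (cA : 'M[quantifier]_(m, n)) (beta : 'cV[quantifier]_m)
    (c : param m n -> R) (s : seq (param m n)) (i : 'I_m) : R :=
  \sum_(p <- s | param_row p == i)
     qsign R (param_entry cA beta p) * radius (param_entry A b p) * `|c p|.

(** The form of [row_forall_exists] that is inherited by suffixes of a prefix:
    [index] comparisons are meaningless for parameters outside the suffix. *)
Definition no_forall_after_exists (m n : nat) (cA : 'M[quantifier]_(m, n))
    (beta : 'cV[quantifier]_m) (s : seq (param m n)) (i : 'I_m) : Prop :=
  forall s1 p s2, s = s1 ++ p :: s2 ->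
    param_row p = i -> param_entry cA beta p = QExists ->
    forall q, q \in s2 -> param_row q = i -> param_entry cA beta q = QExists.

Lemma row_forall_exists_suffix (m n : nat) (cA : 'M[quantifier]_(m, n))
    (beta : 'cV[quantifier]_m) (Q : seq (param m n)) (i : 'I_m) :
  uniq Q -> row_forall_exists cA beta Q i ->
  no_forall_after_exists cA beta Q i.
Proof.
move=> uQ H s1 p s2 EQ pi pE q qs2 qi.
case Eq: (param_entry cA beta q) => //.
have := H q p qi pi Eq pE; move: uQ; rewrite EQ cat_uniq /=.
move=> /and3P[_ /norP[ps1 /hasPn s2s1] _].
rewrite !index_cat (negPf ps1) (negPf (s2s1 q qs2)) /= eqxx addn0.
by rewrite ltnNge leq_addr.
Qed.

(** After an existential quantifier of row [i], the inner quantifiers of that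
    row are existential too and contribute with sign [+1]. *)
Lemma budget_ge0 (R : realType) (m n : nat) (A : 'M[IR R]_(m, n))
    (b : 'cV[IR R]_m) (cA : 'M[quantifier]_(m, n)) (beta : 'cV[quantifier]_m)
    (c : param m n -> R) (s : seq (param m n)) (i : 'I_m) :
  (forall q, q \in s -> param_row q = i ->
     param_entry cA beta q = QExists) ->
  0 <= budget A b cA beta c s i.
Proof.
move=> sE; rewrite /budget big_seq_cond; apply: sumr_ge0 => q /andP[qs /eqP qi].
by rewrite sE //= mul1r mulr_ge0 ?radius_ge0.
Qed.

(** Stated for every suffix [s] of a prefix and every valuation [v] of the
    outer parameters, so that the induction on [s] goes through. *)
Lemma quantify_le_budget (R : realType) (m n : nat) (A : 'M[IR R]_(m, n))
    (b : 'cV[IR R]_m) (cA : 'M[quantifier]_(m, n)) (beta : 'cV[quantifier]_m)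
    (sigma : 'I_m -> relsym) (c : param m n -> R) (s : seq (param m n)) :
  uniq s ->
  (forall i, sigma i = RelEq -> no_forall_after_exists cA beta s i) ->
  forall v,
  quantify A b cA beta s
    (fun w => forall i, rel_holds (sigma i) (row_form c w i) 0) v <->
  forall i, residual (sigma i) (row_form c (at_midpoints A b s v) i)
            <= budget A b cA beta c s i.
Proof.
elim: s => [|p s IH] /= => [_ _ v | /andP[ps us] ord v].
  by split=> H i; move: (H i); rewrite /budget big_nil => /rel_holds_residual.
have ord' i : sigma i = RelEq -> no_forall_after_exists cA beta s i.
  by move=> si s1 q s2 E; apply: (ord i si (p :: s1)); rewrite E.
pose i0 := param_row p.
pose y := row_form c (at_midpoints A b (p :: s) v) i0.
pose C := forall i, i != i0 ->
  residual (sigma i) (row_form c (at_midpoints A b (p :: s) v) i)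
  <= budget A b cA beta c (p :: s) i.
have form t i :
    row_form c (at_midpoints A b s [eta v with p |-> t]) i =
    row_form c (at_midpoints A b (p :: s) v) i +
    (if i0 == i then c p * (t - midpoint (param_entry A b p)) else 0).
  rewrite (@row_form_update _ _ _ _ (at_midpoints A b (p :: s) v) _ p).
    by rewrite /at_midpoints in_cons eqxx (negPf ps) /= eqxx.
  by move=> q qp; rewrite /at_midpoints in_cons (negPf qp) /= (negPf qp).
(* Only the row of p sees the value t. *)
have split_rows t :
    quantify A b cA beta s
      (fun w => forall i, rel_holds (sigma i) (row_form c w i) 0)
      [eta v with p |-> t] <->
    residual (sigma i0) (y + c p * (t - midpoint (param_entry A b p)))
      <= budget A b cA beta c s i0 /\ C.
  rewrite (IH us ord'); split=> [H | [H0 HC] i].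
    split=> [|i ii0]; first by have := H i0; rewrite form eqxx.
    have := H i; rewrite form eq_sym (negPf ii0) addr0.
    by rewrite /budget big_cons eq_sym (negPf ii0).
  rewrite form; case: eqVneq => [<- // | i0i].
  rewrite addr0; have := HC i; rewrite eq_sym => /(_ i0i).
  by rewrite /budget big_cons (negPf i0i).
rewrite (bounded_quant_iff _ _ split_rows) bounded_quant_andl.
rewrite bounded_quant_residual => [|pE si0]; last first.
  by apply: budget_ge0; exact: (ord i0 si0 [::] p s).
have -> : budget A b cA beta c s i0 +
    qsign R (param_entry cA beta p) * radius (param_entry A b p) * `|c p| =
    budget A b cA beta c (p :: s) i0.
  by rewrite /budget big_cons eqxx addrC.
split=> [[H0 HC] i | H]; last by split=> [|i _]; exact: H.
by have [-> // | ii0] := eqVneq i i0; exact: HC.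
Qed.

(** * Back to matrices *)

Lemma sum_param_row (R : realType) (m n : nat) (F : param m n -> R)
    (i : 'I_m) :
  \sum_(p : param m n | param_row p == i) F p =
  \sum_j F (inl (i, j)) + F (inr i).
Proof.
rewrite big_sumType /= big_pred1_eq; congr (_ + _).
have := @pair_big_dep R 0 +%R _ _ (pred1 i) (fun _ => xpredT)
  (fun (i : 'I_m) (j : 'I_n) => F (inl (i, j))).
rewrite big_pred1_eq => ->.
by apply: eq_big => [[k l] | [k l] _] //=; rewrite andbT.
Qed.

Lemma quant_prefix_uniq (m n : nat) (Q : seq (param m n)) :
  quant_prefix Q -> uniq Q.
Proof.
by move=> hQ; apply: count_mem_uniq => p; rewrite hQ -has_pred1 has_count hQ.
Qed.

Lemma quant_prefix_mem (m n : nat) (Q : seq (param m n)) (p : param m n) :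
  quant_prefix Q -> p \in Q.
Proof. by move=> hQ; rewrite -has_pred1 has_count hQ. Qed.

Lemma quant_prefix_big (R : realType) (m n : nat) (Q : seq (param m n))
    (P : pred (param m n)) (F : param m n -> R) :
  quant_prefix Q -> \sum_(p <- Q | P p) F p = \sum_(p | P p) F p.
Proof.
move=> hQ; apply: perm_big; apply: uniq_perm.
- exact: quant_prefix_uniq.
- exact: index_enum_uniq.
- by move=> p; rewrite mem_index_enum quant_prefix_mem.
Qed.

Definition system_coef (R : realType) (m n : nat) (x : 'cV[R]_n)
    (p : param m n) : R :=
  match p with inl ij => x ij.2 ord0 | inr _ => -1 end.

Lemma row_form_system (R : realType) (m n : nat) (x : 'cV[R]_n)
    (v : param m n -> R) (i : 'I_m) :
  row_form (system_coef x) v i =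
  ((\matrix_(i, j) v (inl (i, j))) *m x) i ord0 - (\col_i v (inr i)) i ord0.
Proof.
rewrite /row_form sum_param_row /= !mxE mulN1r; congr (_ - _).
by apply: eq_bigr => j _; rewrite mxE mulrC.
Qed.

(** The general case: the systems [Ax = b], [Ax >= b] and [Ax <= b] are
    obtained by taking [sigma] constant. *)
Lemma quantified_rel_system (R : realType) (m n : nat)
    (A : 'M[IR R]_(m, n)) (b : 'cV[IR R]_m)
    (cA : 'M[quantifier]_(m, n)) (beta : 'cV[quantifier]_m)
    (sigma : 'cV[relsym]_m) (Q : seq (param m n)) (x : 'cV[R]_n) :
  quant_prefix Q ->
  (forall i, sigma i ord0 = RelEq -> row_forall_exists cA beta Q i) ->
  quantified A b cA beta Q (rel_system sigma x) <->
  le_cV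
    (abs_sigma sigma
       (map_mx (@midpoint R) A *m x - map_mx (@midpoint R) b))
    (hadamard (map_mx (qsign R) cA) (map_mx (@radius R) A) *m modulus x
     + hadamard (map_mx (qsign R) beta) (map_mx (@radius R) b)).
Proof.
move=> hQ ord.
have uQ := quant_prefix_uniq hQ.
rewrite /quantified (quantify_iff A b cA beta Q (P' := fun w => forall i,
  rel_holds (sigma i ord0) (row_form (system_coef x) w i) 0)); last first.
  move=> v; rewrite /rel_system; split=> H i; have := H i;
    rewrite row_form_system; case: (sigma i ord0) => /=.
  - by move=> ->; rewrite subrr.
  - by rewrite subr_ge0.
  - by rewrite subr_le0.
  - by move/eqP; rewrite subr_eq0 => /eqP.
  - by rewrite subr_ge0.
  - by rewrite subr_le0.
rewrite (quantify_le_budget A b (sigma := fun i => sigma i ord0)) //;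
  last first.
  by move=> i /ord; exact: row_forall_exists_suffix.
have formE i :
    row_form (system_coef x) (at_midpoints A b Q (fun=> 0)) i =
    (map_mx (@midpoint R) A *m x - map_mx (@midpoint R) b) i ord0.
  rewrite row_form_system !mxE /at_midpoints quant_prefix_mem //=.
  congr (_ - _); apply: eq_bigr => j _.
  by rewrite !mxE quant_prefix_mem.
have budgetE i :
    budget A b cA beta (system_coef x) Q i =
    (hadamard (map_mx (qsign R) cA) (map_mx (@radius R) A) *m modulus x
     + hadamard (map_mx (qsign R) beta) (map_mx (@radius R) b)) i ord0.
  rewrite /budget quant_prefix_big // sum_param_row /= !mxE normrN1 mulr1.
  by congr (_ + _); apply: eq_bigr => j _; rewrite !mxE.
have residualE i :
    abs_sigma sigma (map_mx (@midpoint R) A *m x - map_mx (@midpoint R) b)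
      i ord0 =
    residual (sigma i ord0)
      ((map_mx (@midpoint R) A *m x - map_mx (@midpoint R) b) i ord0).
  by rewrite mxE.
by rewrite /le_cV; split=> H i; move: (H i);
  rewrite residualE formE budgetE.
Qed.

Unset Implicit Arguments.
Set Strict Implicit.

Theorem theorem4 (R : realType) (m n : nat)
    (A : 'M[IR R]_(m, n)) (b : 'cV[IR R]_m)
    (cA : 'M[quantifier]_(m, n)) (beta : 'cV[quantifier]_m)
    (sigma : 'cV[relsym]_m)
    (Q Qae Qsigma : seq (param m n))
    (hQ : quant_prefix Q)
    (hQae : quant_prefix Qae)
    (hQae_rows : forall i : 'I_m, row_forall_exists cA beta Qae i)
    (hQsigma : quant_prefix Qsigma)
    (hQsigma_rows : forall i : 'I_m,
       sigma i ord0 = RelEq -> row_forall_exists cA beta Qsigma i)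
    (x : 'cV[R]_n) :
  let Ac := map_mx (@midpoint R) A in
  let bc := map_mx (@midpoint R) b in
  let Ar := map_mx (@radius R) A in
  let br := map_mx (@radius R) b in
  let As := map_mx (qsign R) cA in
  let bs := map_mx (qsign R) beta in
  let bound : 'cV[R]_m := hadamard As Ar *m modulus x + hadamard bs br in
  (quantified A b cA beta Qae (rel_system (const_mx RelEq) x) <->
     le_cV (modulus (Ac *m x - bc)) bound) /\
  (quantified A b cA beta Q (rel_system (const_mx RelGe) x) <->
     le_cV (bc - Ac *m x) bound) /\
  (quantified A b cA beta Q (rel_system (const_mx RelLe) x) <->
     le_cV (Ac *m x - bc) bound) /\
  (quantified A b cA beta Qsigma (rel_system sigma x) <->
     le_cV (abs_sigma sigma (Ac *m x - bc)) bound).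
Proof.
move=> Ac bc Ar br As bs bound.
have le_cV_eql (u v : 'cV[R]_m) : u = v -> le_cV u bound <-> le_cV v bound.
  by move=> ->.
split; [|split; [|split]].
- rewrite quantified_rel_system => [|//|i _]; last exact: hQae_rows.
  by apply: le_cV_eql; apply/colP => i; rewrite /modulus !mxE.
- rewrite quantified_rel_system => [|//|i]; last by rewrite mxE.
  by apply: le_cV_eql; apply/colP => i; rewrite !mxE opprB.
- rewrite quantified_rel_system => [|//|i]; last by rewrite mxE.
  by apply: le_cV_eql; apply/colP => i; rewrite !mxE.
- exact: quantified_rel_system.
Qed.
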